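(* For every positive integer $n$, $$8\sum_{m<n/2}\widetilde{\sigma}(2m)\widetilde{\sigma}(n-2m)=-\widetilde{\sigma}_3(n)-\widetilde{\sigma}_3(n/2)+4n\widetilde{\sigma}(n)-4\widetilde{\sigma}(n/2)-(2n+1)\widehat{\sigma}(n)+(2n+7)\widehat{\sigma}(n/2),$$ $$8\sum_{m<n/2}\widetilde{\sigma}(2m)\widetilde{\sigma}(n/2-m)=-2\widetilde{\sigma}_3(n/2)+\frac n2\widetilde{\sigma}(n)+(3n-3)\widetilde{\sigma}(n/2)-\frac n2\widehat{\sigma}(n)-(n-3)\widehat{\sigma}(n/2),$$ $$8\sum_{m<(n+1)/2}\widetilde{\sigma}(2m-1)\widetilde{\sigma}(n-(2m-1))=-\widetilde{\sigma}_3(n)+\widetilde{\sigma}_3(n/2)+(2n-1)\widehat{\sigma}(n)-(2n-1)\widehat{\sigma}(n/2),$$ $$8\sum_{m<(n+1)/2}\widetilde{\sigma}(2m-1)\widetilde{\sigma}((n+1)/2-m)=(n-1)\widehat{\sigma}(n)-(n-1)\widehat{\sigma}(n/2),$$ $$8\sum_{m<n/2}\widehat{\sigma}(2m)\widetilde{\sigma}(n-2m)=\frac13\widetilde{\sigma}_3(n)-\widetilde{\sigma}_3(n/2)-\frac13\widetilde{\sigma}(n)+(2n-1)\widehat{\sigma}(n/2),$$ $$8\sum_{m<n/2}\widehat{\sigma}(2m)\widetilde{\sigma}(n/2-m)=-\frac23\widetilde{\sigma}_3(n/2)-\frac13\widetilde{\sigma}(n/2)+(n-1)\widehat{\sigma}(n/2),$$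 where the sums run over positive integers $m$ in the indicated ranges.
   Context: For $s,n\in\mathbb{N}$ (positive integers), $\widetilde{\sigma}_s(n)=\sum_{d\mid n}(-1)^{d-1}d^s$ and $\widehat{\sigma}_s(n)=\sum_{d\mid n}(-1)^{\frac nd-1}d^s$; write $\widetilde{\sigma}=\widetilde{\sigma}_1$, $\widehat{\sigma}=\widehat{\sigma}_1$, and set $\widetilde{\sigma}_s(n)=\widehat{\sigma}_s(n)=0$ if $n$ is not a positive integer. *)

(* Defs.v *)
From HB Require Import structures.
From mathcomp Require Import all_boot all_order all_algebra.
Set Implicit Arguments.
Unset Strict Implicit.
Unset Printing Implicit Defensive.
Import Order.TTheory GRing.Theory Num.Theory.
Local Open Scope ring_scope.

(* tsigma = sigma tilde and hsigma = sigma hat, where s and n > 0 are positive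
   integers. Since [divisors 0 = [::]], both vanish at n = 0. *)
Definition tsigma_nat (s n : nat) : rat :=
  \sum_(d <- divisors n) (-1) ^+ (d - 1) * d%:R ^+ s.

Definition hsigma_nat (s n : nat) : rat :=
  \sum_(d <- divisors n) (-1) ^+ (n %/ d - 1) * d%:R ^+ s.

(* The argument is rational, so that n / 2, (n + 1) / 2 - m, etc. make sense;
   the value is 0 unless the argument is a positive integer. *)
Definition tsigma (s : nat) (x : rat) : rat :=
  if x \is a Num.nat then tsigma_nat s (Num.truncn x) else 0.

Definition hsigma (s : nat) (x : rat) : rat :=
  if x \is a Num.nat then hsigma_nat s (Num.truncn x) else 0.

(* Main.v *)
Require Import Defs.
From mathcomp Require Import all_boot all_order all_algebra.
From mathcomp Require Import zify ring lra.
Import Order.TTheory GRing.Theory Num.Theory.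
Local Open Scope ring_scope.

(** Write s for the sum of divisors and D for the dilation (D f)(n) = f(n/2),
    with value 0 at odd n. Separating the even divisors (respectively the
    divisors with even cofactor) gives tilde = s - 4 D s and hat = s - 2 D s,
    while s(2m) = 3 s(m) - 2 (D s)(m) gives tilde(2m) = - s(m) - 2 (D s)(m) and
    hat(2m) = hat(m). Hence each of the six sums is a linear combination of
    convolutions of dilates of s, and since the convolution of two dilates is
    the dilate of the convolution, only three are needed:
    s * s, s * D s and s * D (D s).

    The first two come from Liouville's identity (lemma liouville), which
    evaluates, for any F, the sum of F(|a - b|) - F(a + b) over the positive
    solutions of a x + b y = n by sums over the divisors of n. It rests on the
    bijection (a, b, x, y) |-> (a, a + b, x - y, y) from the solutions with
    x > y to those with a < b, on the symmetry exchanging (a, x) and (b, y), and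
    on the explicit description of the solutions with a = b or x = y. Taking
    F(d) = d^2, so that F(|a - b|) - F(a + b) = - 4 a b, gives s * s; restricting
    the same F to even d gives the sum of a b over a = b mod 2, which involves
    s * D s as its only new convolution.

    The third convolution follows from the other two. For odd n, exactly one of
    k and n - k is even, so (s * s)(n) is twice the sum over even k, which by the
    formula for s(2m) combines s * D s and s * D (D s) (lemma conv_self_odd). For
    n = 2N only even indices contribute, and the same formula reduces the value
    to s * D s and D (s * s) at N. *)

(** * Positive solutions of a x + b y = n *)

(** Unlike [divisors], which is [:: 1] at 0, this list is empty at 0, so that
    divisor sums vanish there and convolutions may run over 0 <= m <= n. *)
Definition divs (n : nat) : seq nat := [seq d <- iota 1 n | (d %| n)%N].

Lemma mem_divs (n d : nat) : (d \in divs n) = (0 < n)%N && (d %| n)%N.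
Proof.
rewrite mem_filter mem_iota andbC; case: n => [|n] //=; first by lia.
case dn: (d %| n.+1)%N; rewrite ?andbF // andbT.
by rewrite (dvdn_gt0 _ dn) //= add1n ltnS (dvdn_leq _ dn).
Qed.

Lemma divs_uniq (n : nat) : uniq (divs n).
Proof. by rewrite filter_uniq ?iota_uniq. Qed.

Definition factorizations (m : nat) : seq (nat * nat) :=
  [seq (d, (m %/ d)%N) | d <- divs m].

(** Each solution is stored as ((a, x), (b, y)); grouping the solutions by the
    value m = a x makes a product of two divisor sums, convolved, a sum over this
    list. *)
Definition solutions (n : nat) : seq ((nat * nat) * (nat * nat)) :=
  [seq pq | m <- iota 1 n.-1,
            pq <- [seq (p, q) | p <- factorizations m,
                                q <- factorizations (n - m)]].

Lemma mem_factorizations (m : nat) (p : nat * nat) :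
  (p \in factorizations m) = [&& (0 < p.1)%N, (0 < p.2)%N & (p.1 * p.2 == m)%N].
Proof.
case: p => a x; rewrite /factorizations; apply/mapP/and3P => [[d] | [a0 x0 /eqP <-]].
  rewrite mem_divs => /andP[m0 dm] [-> ->].
  by rewrite divn_gt0 ?(dvdn_gt0 m0 dm) // (dvdn_leq m0 dm) mulnC divnK.
exists a; last by rewrite mulKn.
by rewrite mem_divs muln_gt0 a0 x0 dvdn_mulr.
Qed.

Lemma uniq_factorizations (m : nat) : uniq (factorizations m).
Proof. by rewrite /factorizations map_inj_uniq; [exact: divs_uniq| move=> a b []]. Qed.

Lemma mem_solutions (n a x b y : nat) :
  (((a, x), (b, y)) \in solutions n) =
  [&& (0 < a)%N, (0 < x)%N, (0 < b)%N, (0 < y)%N & (a * x + b * y == n)%N].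
Proof.
apply/allpairsPdep/idP => [[m [[p q] [mn]]] | /and5P[a0 x0 b0 y0 /eqP <-]].
  move/allpairsP => [[p' q']] /= [pm qm [-> ->]] [Ep Eq].
  move: pm qm; rewrite -Ep -Eq !mem_factorizations /=.
  move=> /and3P[-> -> /eqP ax] /and3P[-> -> /eqP by_] /=.
  by move: mn; rewrite mem_iota ax by_; lia.
have ax0 : (0 < a * x)%N by rewrite muln_gt0 a0.
have by0 : (0 < b * y)%N by rewrite muln_gt0 b0.
exists (a * x)%N, ((a, x), (b, y)); split=> //; first by rewrite mem_iota; lia.
apply/allpairsP; exists ((a, x), (b, y)); split=> //=;
  by rewrite mem_factorizations /= ?addKn ?a0 ?x0 ?b0 ?y0 /= ?eqxx.
Qed.

Lemma uniq_solutions (n : nat) : uniq (solutions n).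
Proof.
apply: allpairs_uniq_dep; first exact: iota_uniq.
  move=> m _; apply: allpairs_uniq; try exact: uniq_factorizations.
  by move=> [? ?] [? ?] _ _ /= [-> ->].
move=> _ _ /allpairsPdep[m [pq [_ pqm ->]]] /allpairsPdep[m' [pq' [_ pqm' ->]]] /=.
move=> E; rewrite -E in pqm' *; suff -> : m = m' by [].
move: pqm pqm' => /allpairsP[[p q] [/= pm _ ->]] /allpairsP[[p' q'] [/= pm' _ [E1 _]]].
move: pm pm'; rewrite -E1 !mem_factorizations.
by move=> /and3P[_ _ /eqP <-] /and3P[_ _ /eqP].
Qed.

Lemma sum_solutions_prod (n : nat) (f g : nat -> rat) :
  \sum_(q <- solutions n) f q.1.1 * g q.2.1
    = \sum_(m <- iota 1 n.-1)
        (\sum_(d <- divs m) f d) * (\sum_(d <- divs (n - m)) g d).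
Proof.
rewrite big_allpairs_dep; apply: eq_bigr => m _.
rewrite big_allpairs big_map mulr_suml; apply: eq_bigr => a _ /=.
by rewrite big_map mulr_sumr.
Qed.

(** * Liouville's identity *)

Lemma reindex_solutions (n : nat) (P P' : pred ((nat * nat) * (nat * nat)))
    (h h' : (nat * nat) * (nat * nat) -> (nat * nat) * (nat * nat))
    (G : (nat * nat) * (nat * nat) -> rat) :
  {in solutions n, forall q, P q ->
     [/\ h q \in solutions n, P' (h q) & h' (h q) = q]} ->
  {in solutions n, forall q, P' q ->
     [/\ h' q \in solutions n, P (h' q) & h (h' q) = q]} ->
  \sum_(q <- solutions n | P q) G (h q) = \sum_(q <- solutions n | P' q) G q.
Proof.
move=> hP h'P; rewrite -big_filter -[RHS]big_filter -(big_map h xpredT G).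
apply: perm_big; apply: uniq_perm.
- rewrite map_inj_in_uniq ?filter_uniq ?uniq_solutions // => q q'.
  rewrite !mem_filter => /andP[Pq qS] /andP[Pq' qS'] E.
  by have [_ _ <-] := hP q qS Pq; rewrite E; have [_ _ ->] := hP q' qS' Pq'.
- by rewrite filter_uniq ?uniq_solutions.
move=> q; rewrite mem_filter; apply/mapP/andP => [[q' ] | [Pq qS]].
  by rewrite mem_filter => /andP[Pq' qS'] ->; have [] := hP q' qS' Pq'.
have [? ? E] := h'P q qS Pq; exists (h' q); last by rewrite E.
by rewrite mem_filter; apply/andP.
Qed.

Lemma swap_solutions (n : nat) (P : pred ((nat * nat) * (nat * nat)))
    (G : (nat * nat) * (nat * nat) -> rat) :
  \sum_(q <- solutions n | P (q.2, q.1)) G (q.2, q.1)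
    = \sum_(q <- solutions n | P q) G q.
Proof.
pose sw (q : (nat * nat) * (nat * nat)) := (q.2, q.1).
apply: (@reindex_solutions n (fun q => P (sw q)) P sw sw G) => -[[a x] [b y]];
  by rewrite /sw !mem_solutions /= => /and5P[-> -> -> -> /eqP <-] ->;
     rewrite addnC eqxx.
Qed.

(** The bijection behind Liouville's identity: a x + b y = a (x - y) + (a + b) y,
    so (a, b, x, y) |-> (a, a + b, x - y, y) sends the solutions with x > y onto
    those whose second factor exceeds the first. *)
Lemma shear_solutions (n : nat) (G : nat -> nat -> rat) :
  \sum_(q <- solutions n | (q.2.2 < q.1.2)%N) G q.1.1 (q.1.1 + q.2.1)%N
    = \sum_(q <- solutions n | (q.1.1 < q.2.1)%N) G q.1.1 q.2.1.
Proof.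
pose h (q : (nat * nat) * (nat * nat)) :=
  ((q.1.1, q.1.2 - q.2.2), (q.1.1 + q.2.1, q.2.2))%N.
pose h' (q : (nat * nat) * (nat * nat)) :=
  ((q.1.1, q.1.2 + q.2.2), (q.2.1 - q.1.1, q.2.2))%N.
apply: (@reindex_solutions n _ _ h h' (fun q => G q.1.1 q.2.1)) => -[[a x] [b y]];
  rewrite /h /h' !mem_solutions /= => /and5P[a0 x0 b0 y0 /eqP E] lt.
  split; rewrite ?a0 ?y0; [nia | lia | by congr (_, _, (_, _)); lia].
split; rewrite ?a0 ?y0; [nia | lia | by congr (_, _, (_, _)); lia].
Qed.

(** If x = y then (a + b) x = n: the solutions are a divisor d = a + b of n
    together with a splitting of d. *)
Lemma sum_solutions_eq_cofactor (n : nat) (G : nat -> nat -> rat) :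
  \sum_(q <- solutions n | q.1.2 == q.2.2) G q.1.1 q.2.1
    = \sum_(d <- divs n) \sum_(l <- iota 1 d.-1) G l (d - l)%N.
Proof.
pose s : seq ((nat * nat) * (nat * nat)) :=
  [seq ((l, n %/ d), (d - l, n %/ d))%N | d <- divs n, l <- iota 1 d.-1].
transitivity (\sum_(q <- s) G q.1.1 q.2.1); last by rewrite big_allpairs_dep.
rewrite -big_filter; apply: perm_big; apply: uniq_perm.
- by rewrite filter_uniq ?uniq_solutions.
- apply: allpairs_uniq_dep; first exact: divs_uniq.
    by move=> *; exact: iota_uniq.
  move=> _ _ /allpairsPdep[d [l [_ ld ->]]] /allpairsPdep[d' [l' [_ ld' ->]]] /=.
  case=> E _ E' _; rewrite !mem_iota in ld ld'; subst l'.
  by suff -> : d = d' by []; lia.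
move=> [[a x] [b y]]; rewrite mem_filter mem_solutions /=.
apply/andP/allpairsPdep => [[/eqP <-] /and5P[a0 x0 b0 _ /eqP E] | [d [l [dn ld]]]].
  exists (a + b)%N, a; split.
  - by rewrite mem_divs -E -mulnDl dvdn_mulr // andbT muln_gt0 x0; lia.
  - by rewrite mem_iota; lia.
  by rewrite -E -mulnDl mulKn ?addKn // ; lia.
rewrite mem_iota in ld; rewrite mem_divs in dn.
case/andP: dn => n0 /dvdnP[k nE]; rewrite nE mulnK; last by lia.
case=> -> -> -> ->; split=> //; nia.
Qed.

(** If a = b then a (x + y) = n: the factor is a divisor d of n, and its
    cofactor n / d splits as x + y in n / d - 1 ways. *)
Lemma sum_solutions_eq_factor (n : nat) (F : nat -> rat) :
  \sum_(q <- solutions n | q.1.1 == q.2.1) F q.1.1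
    = \sum_(d <- divs n) F d *+ (n %/ d).-1.
Proof.
pose s : seq ((nat * nat) * (nat * nat)) :=
  [seq ((d, l), (d, n %/ d - l))%N | d <- divs n, l <- iota 1 (n %/ d).-1].
transitivity (\sum_(q <- s) F q.1.1); last first.
  rewrite big_allpairs_dep; apply: eq_bigr => d _ /=.
  by rewrite big_const_seq count_predT size_iota -Monoid.iteropE.
rewrite -big_filter; apply: perm_big; apply: uniq_perm.
- by rewrite filter_uniq ?uniq_solutions.
- apply: allpairs_uniq_dep; first exact: divs_uniq.
    by move=> *; exact: iota_uniq.
  move=> _ _ /allpairsPdep[d [l [_ ld ->]]] /allpairsPdep[d' [l' [_ ld' ->]]] /=.
  by case=> -> ->.
move=> [[a x] [b y]]; rewrite mem_filter mem_solutions /=.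
apply/andP/allpairsPdep => [[/eqP <-] /and5P[a0 x0 _ y0 /eqP E] | [d [l [dn ld]]]].
  exists a, x; split.
  - by rewrite mem_divs -E -mulnDr dvdn_mulr // andbT muln_gt0 a0; lia.
  - by rewrite mem_iota -E -mulnDr mulKn //; lia.
  by rewrite -E -mulnDr mulKn ?addKn.
rewrite mem_iota in ld; rewrite mem_divs in dn.
case/andP: dn => n0 /dvdnP[k nE].
have d0 : (0 < d)%N by case: d nE {ld}; lia.
move: ld; rewrite nE mulnK // => ld [-> -> -> ->]; split=> //; nia.
Qed.

Lemma sum_trichotomy (n : nat) (u v : (nat * nat) * (nat * nat) -> nat)
    (G : (nat * nat) * (nat * nat) -> rat) :
  \sum_(q <- solutions n) G q
    = \sum_(q <- solutions n | u q == v q) G q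
      + \sum_(q <- solutions n | (u q < v q)%N) G q
      + \sum_(q <- solutions n | (v q < u q)%N) G q.
Proof.
rewrite [in RHS]big_mkcond [X in _ + X + _]big_mkcond [X in _ + _ + X]big_mkcond.
rewrite -!big_split; apply: eq_bigr => q _ /=.
by case: (ltngtP (u q) (v q)); rewrite ?addr0 ?add0r.
Qed.

(** Split the sum of F(|a - b|) by the order of a and b, that of F(a + b) by the
    order of x and y. After the shear and the symmetry, the off-diagonal parts
    are twice X = sum of F(a) over x < y and twice Y = sum of F(a) over b < a.
    Computing the sum of F(a) over all solutions in both ways, the shear cancels
    the parts x > y and a < b, so that X - Y is a difference of diagonal sums. *)
Theorem liouville (n : nat) (F : nat -> rat) :
  \sum_(q <- solutions n)
     (F ((q.1.1 - q.2.1) + (q.2.1 - q.1.1))%N - F (q.1.1 + q.2.1)%N)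
    = \sum_(d <- divs n) (F 0%N *+ (n %/ d).-1 + F d *+ (n %/ d).-1 *+ 2
         - F d *+ d.-1 - (\sum_(l <- iota 1 d.-1) F l) *+ 2).
Proof.
set S := solutions n.
pose X := \sum_(q <- S | (q.1.2 < q.2.2)%N) F q.1.1.
pose Y := \sum_(q <- S | (q.2.1 < q.1.1)%N) F q.1.1.
pose Z := \sum_(q <- S | (q.1.1 < q.2.1)%N) F q.1.1.
have diff : \sum_(q <- S) F ((q.1.1 - q.2.1) + (q.2.1 - q.1.1))%N
    = \sum_(d <- divs n) F 0%N *+ (n %/ d).-1 + X *+ 2.
  rewrite (sum_trichotomy n (fun q => q.1.1) (fun q => q.2.1)).
  rewrite -(sum_solutions_eq_factor n (fun=> F 0%N)) mulr2n addrA.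
  have lt_half : \sum_(q <- S | (q.1.1 < q.2.1)%N)
      F ((q.1.1 - q.2.1) + (q.2.1 - q.1.1))%N = X.
    transitivity (\sum_(q <- S | (q.1.1 < q.2.1)%N) F (q.2.1 - q.1.1)%N).
      by apply: eq_bigr => q lt; congr F; lia.
    rewrite -(shear_solutions n (fun a c => F (c - a)%N)) -(swap_solutions n).
    by apply: eq_bigr => q _ /=; rewrite addKn.
  congr (_ + _ + _); first by apply: eq_bigr => q /eqP ->; rewrite subnn.
    exact: lt_half.
  by rewrite -lt_half -[LHS](swap_solutions n); apply: eq_bigr => q _; rewrite addnC.
have tot : \sum_(q <- S) F (q.1.1 + q.2.1)%N
    = \sum_(d <- divs n) F d *+ d.-1 + Y *+ 2.
  rewrite (sum_trichotomy n (fun q => q.1.2) (fun q => q.2.2)).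
  rewrite (sum_solutions_eq_cofactor n (fun a b => F (a + b)%N)) mulr2n addrA.
  have gt_half : \sum_(q <- S | (q.2.2 < q.1.2)%N) F (q.1.1 + q.2.1)%N = Y.
    by rewrite (shear_solutions n (fun _ c => F c)) -[LHS](swap_solutions n).
  congr (_ + _ + _) => //; last first.
    by rewrite -gt_half -[LHS](swap_solutions n); apply: eq_bigr => q _; rewrite addnC.
  apply: eq_bigr => d _.
  rewrite (eq_big_seq (fun=> F d)) => [|l]; last first.
    by rewrite mem_iota => ld; congr F; lia.
  by rewrite big_const_seq count_predT size_iota -Monoid.iteropE.
have XY : X = Y + \sum_(d <- divs n) F d *+ (n %/ d).-1
    - \sum_(d <- divs n) \sum_(l <- iota 1 d.-1) F l.
  have := sum_trichotomy n (fun q => q.1.2) (fun q => q.2.2) (fun q => F q.1.1).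
  rewrite (sum_trichotomy n (fun q => q.1.1) (fun q => q.2.1)).
  rewrite (sum_solutions_eq_cofactor n (fun a _ => F a)) sum_solutions_eq_factor.
  rewrite (shear_solutions n (fun a _ => F a)) -/S -/X -/Y -/Z => E.
  by apply: (addIr Z); move: E; lra.
rewrite sumrB diff tot XY !sumrB big_split /= !sumrMnl; lra.
Qed.

(** * Divisor sums, dilations and convolutions *)

Definition dsum (f : nat -> rat) (n : nat) : rat := \sum_(d <- divs n) f d.
Definition sigma (k n : nat) : rat := dsum (fun d => d%:R ^+ k) n.
(** On generating functions this is the substitution of q^2 for q. *)
Definition dilate (f : nat -> rat) (n : nat) : rat := if odd n then 0 else f n./2.
Definition oddpart (f : nat -> rat) (n : nat) : rat := if odd n then f n else 0.
Definition conv (f g : nat -> rat) (n : nat) : rat :=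
  \sum_(m < n.+1) f m * g (n - m)%N.

Lemma dsum0 (f : nat -> rat) : dsum f 0 = 0.
Proof. exact: big_nil. Qed.

Lemma sigma0 (k : nat) : sigma k 0 = 0.
Proof. exact: dsum0. Qed.

Lemma dilate0 (f : nat -> rat) : f 0%N = 0 -> dilate f 0 = 0.
Proof. by []. Qed.

Lemma dilate_double (f : nat -> rat) (n : nat) : dilate f n.*2 = f n.
Proof. by rewrite /dilate odd_double doubleK. Qed.

Lemma eq_dilate (f g : nat -> rat) : f =1 g -> dilate f =1 dilate g.
Proof. by move=> fg n; rewrite /dilate fg. Qed.

Lemma oddpartE (f : nat -> rat) (n : nat) :
  oddpart f n = f n - dilate (fun m => f m.*2) n.
Proof.
rewrite /oddpart /dilate; case: ifP => on; first by rewrite subr0.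
by rewrite even_halfK ?on // subrr.
Qed.

(** The even divisors of n are the doubles of the divisors of n / 2. *)
Lemma sum_divs_even (f : nat -> rat) (n : nat) :
  \sum_(d <- divs n | ~~ odd d) f d = dilate (dsum (fun d => f d.*2)) n.
Proof.
rewrite /dilate; case: ifP => on.
  rewrite big1_seq // => d /andP[ed]; rewrite mem_divs => /andP[_ dn].
  by move: (dvdn_odd dn on); rewrite (negbTE ed).
rewrite /dsum -big_filter -(big_map double xpredT f).
apply: perm_big; apply: uniq_perm; first exact: filter_uniq (divs_uniq _).
  by rewrite map_inj_uniq ?divs_uniq //; exact: double_inj.
move=> d; rewrite mem_filter mem_divs.
rewrite -{1 2}(even_halfK (negbT on)).
apply/and3P/mapP => [[ed n0 dn] | [c]].
  exists d./2; last by rewrite even_halfK.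
  rewrite mem_divs; move: dn n0; rewrite -{1}(even_halfK ed) -!muln2 dvdn_pmul2r //.
  by move=> ->; lia.
rewrite mem_divs => /andP[n0 cn] ->; rewrite odd_double -!muln2 dvdn_pmul2r //.
by split=> //; lia.
Qed.

(** A divisor d of n has even cofactor exactly when d divides n / 2. *)
Lemma sum_divs_even_cofactor (f : nat -> rat) (n : nat) :
  \sum_(d <- divs n | ~~ odd (n %/ d)) f d = dilate (dsum f) n.
Proof.
rewrite /dilate; case: ifP => on.
  rewrite big1_seq // => d /andP[ed]; rewrite mem_divs => /andP[_ dn].
  by move: on; rewrite -(divnK dn) oddM (negbTE ed).
rewrite /dsum -big_filter.
apply: perm_big; apply: uniq_perm.
- exact: filter_uniq (divs_uniq _).
- exact: divs_uniq.
move=> d; rewrite mem_filter !mem_divs.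
move: (even_halfK (negbT on)) => nE.
apply/and3P/andP => [[ed n0 /dvdnP[k kd]] | [n0 /dvdnP[k kd]]].
  have d0 : (0 < d)%N by case: d kd {ed}; lia.
  rewrite kd mulnK // in ed; split; first by lia.
  by apply/dvdnP; exists k./2; apply: double_inj; rewrite nE kd doubleMl even_halfK.
have d0 : (0 < d)%N by case: d kd; lia.
have E : (n = k.*2 * d)%N by rewrite -nE kd doubleMl.
by rewrite {1 3}E mulnK // odd_double dvdn_mull //; split=> //; lia.
Qed.

(** n and 2 n have the same odd divisors, and the even divisors contribute
    2 ^ k times the value at half the argument. *)
Lemma sigma_double (k n : nat) :
  sigma k n.*2 = (1 + 2 ^+ k) * sigma k n - 2 ^+ k * dilate (sigma k) n.
Proof.
have even_sum m : \sum_(d <- divs m | ~~ odd d) d%:R ^+ k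
    = 2 ^+ k * dilate (sigma k) m :> rat.
  rewrite sum_divs_even /dilate; case: ifP => _; rewrite ?mulr0 // /sigma /dsum mulr_sumr.
  by apply: eq_bigr => d _; rewrite -muln2 natrM exprMn mulrC.
have odd_sum : \sum_(d <- divs n.*2 | odd d) d%:R ^+ k
    = \sum_(d <- divs n | odd d) d%:R ^+ k :> rat.
  rewrite -big_filter -[RHS]big_filter; apply: perm_big.
  apply: uniq_perm => [||d]; do ?exact: filter_uniq (divs_uniq _).
  rewrite mem_filter [RHS]mem_filter !mem_divs double_gt0; case od: (odd d) => //=.
  by rewrite -muln2 Gauss_dvdl // coprimen2.
have split m : sigma k m = \sum_(d <- divs m | odd d) d%:R ^+ k
    + 2 ^+ k * dilate (sigma k) m.
  by rewrite -even_sum /sigma /dsum (bigID odd).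
by rewrite (split n.*2) odd_sum dilate_double (split n) -/(dilate _); ring.
Qed.

Lemma eq_conv (f f' g g' : nat -> rat) (n : nat) :
  f =1 f' -> g =1 g' -> conv f g n = conv f' g' n.
Proof. by move=> ff' gg'; apply: eq_bigr => m _; rewrite ff' gg'. Qed.

Lemma convC (f g : nat -> rat) (n : nat) : conv f g n = conv g f n.
Proof.
rewrite /conv (reindex_inj rev_ord_inj) /=; apply: eq_bigr => m _.
by rewrite mulrC subSS subKn // -ltnS.
Qed.

(** Every function is padded to two terms with explicit coefficients, possibly 0,
    so that rewriting finds the coefficients by unification. *)
Lemma conv_bilinear (a b c d : rat) (f f' g g' : nat -> rat) (n : nat) :
  conv (fun m => a * f m + b * f' m) (fun m => c * g m + d * g' m) n
    = a * c * conv f g n + a * d * conv f g' n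
      + b * c * conv f' g n + b * d * conv f' g' n.
Proof.
rewrite /conv !mulr_sumr -!big_split; apply: eq_bigr => m _ /=; ring.
Qed.

(** Beyond n the truncated subtraction gives the argument 0, where g vanishes;
    this frees the upper bound, so that sums can be split by parity. *)
Lemma conv_wide (f g : nat -> rat) (n N : nat) :
  g 0%N = 0 -> (n < N)%N -> conv f g n = \sum_(m < N) f m * g (n - m)%N.
Proof.
move=> g0 nN; rewrite /conv -(big_mkord xpredT (fun m => f m * g (n - m)%N)).
rewrite -(big_mkord xpredT (fun m => f m * g (n - m)%N)).
rewrite (@big_cat_nat _ _ _ n.+1 0 N) //= [X in _ + X]big_nat [X in _ + X]big1 ?addr0 // => m.
move=> /andP[nm _]; have -> : (n - m = 0)%N by lia.
by rewrite g0 mulr0.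
Qed.

Lemma sum_parity (f : nat -> rat) (N : nat) :
  \sum_(m < N.*2) f m = \sum_(m < N) f m.*2 + \sum_(m < N) f m.*2.+1.
Proof.
elim: N => [|N IH]; first by rewrite !big_ord0 addr0.
by rewrite doubleS !big_ord_recr /= IH; ring.
Qed.

Lemma conv_dilate (f g : nat -> rat) (n : nat) :
  g 0%N = 0 -> conv (dilate f) g n = \sum_(m < n.+1) f m * g (n - m.*2)%N.
Proof.
move=> g0; rewrite (@conv_wide _ _ n n.+1.*2) //; last by lia.
rewrite (sum_parity (fun m => dilate f m * g (n - m)%N)) [X in _ + X]big1 ?addr0 => [|m _].
  by apply: eq_bigr => m _; rewrite dilate_double.
by rewrite /dilate /= odd_double mul0r.
Qed.

Lemma conv_oddpart (f g : nat -> rat) (n : nat) :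
  g 0%N = 0 -> conv (oddpart f) g n = \sum_(m < n.+1) f m.*2.+1 * g (n - m.*2.+1)%N.
Proof.
move=> g0; rewrite (@conv_wide _ _ n n.+1.*2) //; last by lia.
rewrite (sum_parity (fun m => oddpart f m * g (n - m)%N)) big1 ?add0r => [|m _].
  by apply: eq_bigr => m _; rewrite /oddpart /= odd_double.
by rewrite /oddpart /= odd_double mul0r.
Qed.

Lemma conv_dilate_dilate (f g : nat -> rat) (n : nat) :
  g 0%N = 0 -> conv (dilate f) (dilate g) n = dilate (conv f g) n.
Proof.
move=> g0; rewrite conv_dilate ?dilate0 // {2}/dilate; case: ifP => on.
  rewrite big1 // => m _; rewrite /dilate; case: ifP => on'; first by rewrite mulr0.
  have -> : ((n - m.*2)./2 = 0)%N by lia.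
  by rewrite g0 mulr0.
rewrite (@conv_wide _ _ n./2 n.+1) //; last by lia.
apply: eq_bigr => m _; congr (_ * _).
by rewrite -{1}(even_halfK (negbT on)) -doubleB dilate_double.
Qed.

(** * The three convolutions of the sum of divisors *)

(** This is where convolutions meet the solutions of a x + b y = n. *)
Lemma conv_dsum (f g : nat -> rat) (n : nat) :
  conv (dsum f) (dsum g) n = \sum_(q <- solutions n) f q.1.1 * g q.2.1.
Proof.
rewrite sum_solutions_prod /conv; case: n => [|n].
  by rewrite big_nil big_ord1 dsum0 mul0r.
rewrite -(big_mkord xpredT (fun m => dsum f m * dsum g (n.+1 - m)%N)) /=.
rewrite big_nat_recr //= subnn dsum0 mulr0 addr0 big_ltn //= dsum0 mul0r add0r.
by rewrite /index_iota subSS subn0.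
Qed.

Lemma sum_squares (n : nat) :
  \sum_(l <- iota 1 n) l%:R ^+ 2 = n%:R * (n%:R + 1) * (2 * n%:R + 1) / 6 :> rat.
Proof.
elim: n => [|n IH]; first by rewrite big_nil; ring.
by rewrite -[n.+1]addn1 iotaD big_cat IH big_seq1 /= add1n -natr1; field.
Qed.

Lemma sum_even_squares (n : nat) :
  \sum_(l <- iota 1 n) (~~ odd l)%:R * l%:R ^+ 2
    = n%:R * (n%:R + 1) * (if odd n then n%:R - 1 else n%:R + 2) / 6 :> rat.
Proof.
elim: n => [|n IH]; first by rewrite big_nil; ring.
rewrite -[n.+1]addn1 iotaD big_cat IH big_seq1 /= add1n addn1 /= -natr1.
by case: (odd n) => /=; field.
Qed.

(** Liouville's identity for F(d) = d ^ 2, as (a - b) ^ 2 - (a + b) ^ 2 = - 4 a b. *)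
Lemma convolution_sigma (n : nat) :
  conv (sigma 1) (sigma 1) n
    = 5 / 12 * sigma 3 n + 1 / 12 * sigma 1 n - n%:R / 2 * sigma 1 n.
Proof.
rewrite conv_dsum; have := liouville n (fun d => d%:R ^+ 2).
rewrite (eq_bigr (fun q => -4 * (q.1.1%:R ^+ 1 * q.2.1%:R ^+ 1))) => [|q _]; last first.
  case: (leqP q.1.1 q.2.1) => [/[dup] le | lt].
    rewrite -subn_eq0 => /eqP ->; rewrite add0n natrB // natrD; ring.
  have -> : (q.2.1 - q.1.1 = 0)%N by lia.
  rewrite addn0 natrB 1?ltnW // natrD; ring.
rewrite -mulr_sumr => E; rewrite -[LHS](mulKf (_ : -4 != 0 :> rat)) // {}E.
rewrite /sigma /dsum !mulr_sumr -big_split -sumrB /=.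
rewrite big_seq [RHS]big_seq; apply: eq_bigr => d; rewrite mem_divs.
case/andP=> n0 /dvdnP[k nE]; rewrite sum_squares nE.
have d0 : (0 < d)%N by case: d nE; lia.
have k0 : (0 < k)%N by case: k nE; lia.
(* n = k d; writing d and k as successors removes the predecessors *)
rewrite mulnK // -[d]prednK // -[k]prednK //= natrM -!natr1.
by field.
Qed.

Lemma dsum_even_id (k n : nat) :
  dsum (fun d => (~~ odd d)%:R * d%:R ^+ k) n = 2 ^+ k * dilate (sigma k) n.
Proof.
rewrite /dsum (eq_bigr (fun d => if ~~ odd d then d%:R ^+ k else 0)) => [|d _].
  rewrite -big_mkcond sum_divs_even /dilate; case: ifP => _; first by rewrite mulr0.
  rewrite /sigma /dsum mulr_sumr; apply: eq_bigr => d _.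
  by rewrite -muln2 natrM exprMn mulrC.
by case: odd; rewrite /= ?mul0r ?mul1r.
Qed.

Lemma dilate_convolution_sigma (n : nat) :
  dilate (conv (sigma 1) (sigma 1)) n
    = 5 / 12 * dilate (sigma 3) n + 1 / 12 * dilate (sigma 1) n
      - n%:R / 4 * dilate (sigma 1) n.
Proof.
rewrite /dilate; case: ifP => on; first by ring.
have nE : n%:R = n./2%:R * 2 :> rat.
  by rewrite -natrM muln2 even_halfK ?on.
by rewrite convolution_sigma nE; field.
Qed.

(** Liouville's identity for F(d) = d ^ 2 on even d and 0 on odd d. Its left side
    is - 4 times the sum of a b over a = b mod 2, and the indicator of a = b mod 2
    is 1 - e(a) - e(b) + 2 e(a) e(b) with e the indicator of even numbers. *)
Lemma convolution_sigma_dilate (n : nat) :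
  conv (sigma 1) (dilate (sigma 1)) n
    = 1 / 12 * sigma 3 n + 1 / 3 * dilate (sigma 3) n
      - n%:R / 8 * sigma 1 n - n%:R / 4 * dilate (sigma 1) n
      + 1 / 24 * sigma 1 n + 1 / 24 * dilate (sigma 1) n.
Proof.
pose e (d : nat) : rat := (~~ odd d)%:R * d%:R ^+ 1.
have even_sum m : dsum e m = 0 * dilate (sigma 1) m + 2 * dilate (sigma 1) m.
  by rewrite dsum_even_id; ring.
have lhs : \sum_(q <- solutions n)
    ((~~ odd (q.1.1 - q.2.1 + (q.2.1 - q.1.1)))%:R
       * (q.1.1 - q.2.1 + (q.2.1 - q.1.1))%:R ^+ 2
     - (~~ odd (q.1.1 + q.2.1))%:R * (q.1.1 + q.2.1)%:R ^+ 2)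
  = -4 * (conv (sigma 1) (sigma 1) n - 4 * conv (sigma 1) (dilate (sigma 1)) n
          + 8 * dilate (conv (sigma 1) (sigma 1)) n).
  transitivity (-4 * (conv (sigma 1) (sigma 1) n - conv (dsum e) (sigma 1) n
      - conv (sigma 1) (dsum e) n + 2 * conv (dsum e) (dsum e) n)).
    rewrite !conv_dsum -!sumrB mulr_sumr -big_split mulr_sumr /=.
    apply: eq_bigr => q _; rewrite /e.
    have -> : odd (q.1.1 - q.2.1 + (q.2.1 - q.1.1)) = odd (q.1.1 + q.2.1) by lia.
    rewrite oddD; case: (leqP q.1.1 q.2.1) => [/[dup] le | lt].
      rewrite -subn_eq0 => /eqP ->; rewrite add0n natrB // natrD.
      by case: (odd q.1.1); case: (odd q.2.1) => /=; ring.
    have -> : (q.2.1 - q.1.1 = 0)%N by lia.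
    rewrite addn0 natrB 1?ltnW // natrD.
    by case: (odd q.1.1); case: (odd q.2.1) => /=; ring.
  have id1 m : sigma 1 m = 0 * sigma 1 m + 1 * sigma 1 m by ring.
  rewrite (convC (dsum e)) (eq_conv _ _ _ _ _ id1 even_sum) (eq_conv _ _ _ _ _ even_sum even_sum).
  by rewrite !conv_bilinear conv_dilate_dilate ?sigma0 //; ring.
have := liouville n (fun d => (~~ odd d)%:R * d%:R ^+ 2); rewrite lhs => {lhs} E.
have {}E : -4 * (conv (sigma 1) (sigma 1) n - 4 * conv (sigma 1) (dilate (sigma 1)) n
          + 8 * dilate (conv (sigma 1) (sigma 1)) n)
    = 2 * n%:R * (2 * dilate (sigma 1) n) - 8 * dilate (sigma 3) n
      - 1 / 3 * (sigma 3 n - sigma 1 n) - 2 * dilate (sigma 1) n.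
  rewrite {}E.
  have E1 := dsum_even_id 1 n; have E3 := dsum_even_id 3 n; rewrite expr1 in E1.
  rewrite -E1 (_ : 8 = 2 ^+ 3) // -E3 /sigma /dsum -sumrB !mulr_sumr -!sumrB.
  rewrite big_seq [RHS]big_seq; apply: eq_bigr => d; rewrite mem_divs.
  case/andP=> n0 /dvdnP[k nE]; rewrite sum_even_squares nE.
  have d0 : (0 < d)%N by case: d nE; lia.
  have k0 : (0 < k)%N by case: k nE; lia.
  (* n = k d; writing d and k as successors removes the predecessors *)
  rewrite mulnK // -[d]prednK // -[k]prednK //= natrM -!natr1.
  by case: (odd d.-1) => /=; field.
by move: E; rewrite dilate_convolution_sigma convolution_sigma; lra.
Qed.

(** For odd n exactly one of k and n - k is even, and exchanging them shows that
    even and odd k contribute equally. *)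
Lemma conv_self_odd (f : nat -> rat) (n : nat) : odd n ->
  conv f f n = 2 * conv (dilate (fun m => f m.*2)) f n.
Proof.
move=> on; pose ev (m : nat) := dilate (fun m => f m.*2) m.
have cross (g : nat -> rat) : conv ev g n = conv ev (oddpart g) n.
  apply: eq_bigr => m _; rewrite /ev /dilate /oddpart.
  case: ifP => om; first by rewrite !mul0r.
  by rewrite oddB ?on ?om // -ltnS.
have cross' : conv (oddpart f) f n = conv (oddpart f) ev n.
  apply: eq_bigr => m _; rewrite {1 2}/oddpart; case: ifP => om; last by rewrite !mul0r.
  have e : ~~ odd (n - m) by rewrite oddB ?on ?om // -ltnS.
  by rewrite /ev /dilate (negbTE e) even_halfK.
have split m : f m = 1 * oddpart f m + 1 * ev m by rewrite oddpartE /ev; ring.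
have id1 m : f m = 1 * f m + 0 * f m by ring.
rewrite (eq_conv _ _ _ _ _ split id1) conv_bilinear cross' convC -cross -/ev; ring.
Qed.

(** Odd n: solve the relation of conv_self_odd, where s(2m) is expanded by
    sigma_double. Even n: only even indices contribute, and the same expansion
    leaves known convolutions at n / 2. *)
Lemma convolution_sigma_dilate2 (n : nat) :
  conv (sigma 1) (dilate (dilate (sigma 1))) n
    = 1 / 48 * sigma 3 n + 1 / 16 * dilate (sigma 3) n
      + 1 / 3 * dilate (dilate (sigma 3)) n
      - n%:R / 16 * sigma 1 n - n%:R / 4 * dilate (dilate (sigma 1)) n
      + 1 / 24 * sigma 1 n + 1 / 24 * dilate (dilate (sigma 1)) n.
Proof.
pose s := sigma 1; have s0 : s 0%N = 0 := sigma0 1.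
have double_s m : s m.*2 = 3 * s m + -2 * dilate s m by rewrite /s sigma_double; ring.
case on: (odd n).
  have := conv_self_odd (sigma 1) n on.
  have ev m : dilate (fun m => s m.*2) m = 3 * dilate s m + -2 * dilate (dilate s) m.
    by rewrite /dilate double_s /dilate; case: ifP => _; ring.
  have id1 m : s m = 1 * s m + 0 * s m by ring.
  rewrite (eq_conv _ _ _ _ _ ev id1) conv_bilinear -/s !(convC _ s).
  have hf0 (f : nat -> rat) : dilate f n = 0 by rewrite /dilate on.
  rewrite convolution_sigma_dilate convolution_sigma !hf0 -/s; lra.
rewrite -(even_halfK (negbT on)); set N := n./2.
rewrite convC conv_dilate ?s0 //.
have -> : \sum_(m < N.*2.+1) dilate s m * s (N.*2 - m.*2)%N
    = conv (dilate s) (fun m => 3 * s m + -2 * dilate s m) N.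
  rewrite (@conv_wide _ _ _ N.*2.+1); [|by rewrite /= dilate0 // s0; ring | lia].
  by apply: eq_bigr => m _; rewrite -doubleB double_s.
have id1 m : dilate s m = 1 * dilate s m + 0 * dilate s m by ring.
rewrite (eq_conv _ _ _ _ _ id1 (frefl _)) conv_bilinear (convC (dilate s) s).
rewrite convolution_sigma_dilate conv_dilate_dilate // dilate_convolution_sigma.
rewrite !dilate_double !sigma_double.
by rewrite -muln2 natrM; field.
Qed.

Lemma dilate_convolution_sigma_dilate (n : nat) :
  dilate (conv (sigma 1) (dilate (sigma 1))) n
    = 1 / 12 * dilate (sigma 3) n + 1 / 3 * dilate (dilate (sigma 3)) n
      - n%:R / 16 * dilate (sigma 1) n - n%:R / 8 * dilate (dilate (sigma 1)) n
      + 1 / 24 * dilate (sigma 1) n + 1 / 24 * dilate (dilate (sigma 1)) n.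
Proof.
case on: (odd n); first by rewrite /dilate on; ring.
rewrite -(even_halfK (negbT on)) !dilate_double convolution_sigma_dilate.
by rewrite -muln2 natrM; field.
Qed.

Lemma dilate2_convolution_sigma (n : nat) :
  dilate (dilate (conv (sigma 1) (sigma 1))) n
    = 5 / 12 * dilate (dilate (sigma 3)) n + 1 / 12 * dilate (dilate (sigma 1)) n
      - n%:R / 8 * dilate (dilate (sigma 1)) n.
Proof.
case on: (odd n); first by rewrite /dilate on; ring.
rewrite -(even_halfK (negbT on)) !dilate_double dilate_convolution_sigma.
by rewrite -muln2 natrM; field.
Qed.

(** A rewriting system: every convolution of two dilates of sigma 1 that is needed
    is first brought to one of the forms evaluated above. *)
Lemma conv_dilates_sigmaE (n : nat) (s := sigma 1) :
  (conv (dilate s) s n = conv s (dilate s) n) *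
  (conv (dilate (dilate s)) s n = conv s (dilate (dilate s)) n) *
  (conv (dilate s) (dilate s) n = dilate (conv s s) n) *
  (conv (dilate s) (dilate (dilate s)) n = dilate (conv s (dilate s)) n) *
  (conv (dilate (dilate s)) (dilate s) n = dilate (conv s (dilate s)) n) *
  (conv (dilate (dilate s)) (dilate (dilate s)) n = dilate (dilate (conv s s)) n).
Proof.
have s0 : s 0%N = 0 := sigma0 1.
split; [split; [split; [split; [split|]|]|]|]; try exact: convC.
- by rewrite conv_dilate_dilate.
- by rewrite conv_dilate_dilate ?dilate0.
- by rewrite convC conv_dilate_dilate ?dilate0.
- by rewrite conv_dilate_dilate ?dilate0 //; apply: eq_dilate => m; rewrite conv_dilate_dilate.
Qed.

Definition convolutionE (n : nat) :=
  (conv_dilates_sigmaE n, dilate2_convolution_sigma n, dilate_convolution_sigma_dilate n,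
   dilate_convolution_sigma n, convolution_sigma n, convolution_sigma_dilate n,
   convolution_sigma_dilate2 n).

(** * The functions with signs *)

Definition tilde (k n : nat) : rat := sigma k n - 2 ^+ k.+1 * dilate (sigma k) n.
Definition hat (k n : nat) : rat := sigma k n - 2 * dilate (sigma k) n.

Lemma perm_divisors_divs (n : nat) : (0 < n)%N -> perm_eq (divisors n) (divs n).
Proof.
move=> n0; apply: uniq_perm; rewrite ?divisors_uniq ?divs_uniq // => d.
by rewrite mem_divs n0 -dvdn_divisors.
Qed.

Lemma sign_pred (m : nat) : (0 < m)%N -> (-1) ^+ (m - 1) = 1 - 2 * (~~ odd m)%:R :> rat.
Proof.
by case: m => // m _; rewrite subn1 /= -signr_odd; case: (odd m); rewrite /=; ring.
Qed.

Lemma tsigma_natE (k n : nat) : (0 < n)%N -> tsigma_nat k n = tilde k n.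
Proof.
move=> n0; rewrite /tsigma_nat (perm_big _ (perm_divisors_divs n n0)) /=.
rewrite /tilde exprS -mulrA -dsum_even_id /sigma /dsum mulr_sumr -sumrB.
rewrite big_seq [RHS]big_seq; apply: eq_bigr => d; rewrite mem_divs => /andP[_ dn].
by rewrite sign_pred ?(dvdn_gt0 n0) //; ring.
Qed.

Lemma hsigma_natE (k n : nat) : (0 < n)%N -> hsigma_nat k n = hat k n.
Proof.
move=> n0; rewrite /hsigma_nat (perm_big _ (perm_divisors_divs n n0)) /=.
rewrite /hat -sum_divs_even_cofactor [X in 2 * X]big_mkcond /sigma /dsum mulr_sumr -sumrB.
rewrite big_seq [RHS]big_seq; apply: eq_bigr => d; rewrite mem_divs => /andP[_ dn].
rewrite sign_pred; last by rewrite divn_gt0 ?(dvdn_leq n0) ?(dvdn_gt0 n0).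
by case: odd => /=; ring.
Qed.

Lemma tsigma_natr (k n : nat) : (0 < n)%N -> tsigma k n%:R = tilde k n.
Proof. by move=> n0; rewrite /tsigma natr_nat natrK tsigma_natE. Qed.

Lemma hsigma_natr (k n : nat) : (0 < n)%N -> hsigma k n%:R = hat k n.
Proof. by move=> n0; rewrite /hsigma natr_nat natrK hsigma_natE. Qed.

Lemma half_natr_even (n : nat) : ~~ odd n -> n%:R / 2 = n./2%:R :> rat.
Proof. by move=> en; rewrite -{1}(even_halfK en) -muln2 natrM mulfK. Qed.

Lemma half_natr_odd (n : nat) : odd n -> (n%:R / 2 : rat) \isn't a Num.nat.
Proof.
move=> on; apply/natrP => -[m /(congr1 ( *%R^~ 2))].
rewrite divfK // -natrM => /eqP; rewrite eqr_nat => /eqP nE.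
by move: on; rewrite nE oddM andbF.
Qed.

(** Rational arguments n / 2 amount to dilations, the value at odd n being 0
    on both sides. *)
Lemma tsigma_half (k n : nat) : (0 < n)%N -> tsigma k (n%:R / 2) = dilate (tilde k) n.
Proof.
move=> n0; rewrite /dilate; case: ifP => on.
  by rewrite /tsigma (negbTE (half_natr_odd n on)).
by rewrite half_natr_even ?on // tsigma_natr //; lia.
Qed.

Lemma hsigma_half (k n : nat) : (0 < n)%N -> hsigma k (n%:R / 2) = dilate (hat k) n.
Proof.
move=> n0; rewrite /dilate; case: ifP => on.
  by rewrite /hsigma (negbTE (half_natr_odd n on)).
by rewrite half_natr_even ?on // hsigma_natr //; lia.
Qed.

Lemma dilate_lincomb (a b : rat) (f g : nat -> rat) (n : nat) :
  dilate (fun m => a * f m + b * g m) n = a * dilate f n + b * dilate g n.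
Proof. by rewrite /dilate; case: ifP => _ //; ring. Qed.

Lemma tilde1E (n : nat) : tilde 1 n = 1 * sigma 1 n + -4 * dilate (sigma 1) n.
Proof. by rewrite /tilde; ring. Qed.

Lemma hat1E (n : nat) : hat 1 n = 1 * sigma 1 n + -2 * dilate (sigma 1) n.
Proof. by rewrite /hat; ring. Qed.

Lemma tilde_double (n : nat) :
  tilde 1 n.*2 = -1 * sigma 1 n + -2 * dilate (sigma 1) n.
Proof. by rewrite /tilde sigma_double dilate_double; ring. Qed.

Lemma hat_double (n : nat) : hat 1 n.*2 = hat 1 n.
Proof. by rewrite /hat sigma_double dilate_double; ring. Qed.

Lemma tilde0 : tilde 1 0 = 0.
Proof. by rewrite tilde1E /dilate /= sigma0; ring. Qed.

Lemma hat0 : hat 1 0 = 0.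
Proof. by rewrite hat1E /dilate /= sigma0; ring. Qed.

Lemma tilde3E (n : nat) : tilde 3 n = 1 * sigma 3 n + -16 * dilate (sigma 3) n.
Proof. by rewrite /tilde; ring. Qed.

Lemma dilate_tilde1 (n : nat) :
  dilate (tilde 1) n = 1 * dilate (sigma 1) n + -4 * dilate (dilate (sigma 1)) n.
Proof. by rewrite (eq_dilate _ _ tilde1E) dilate_lincomb. Qed.

Lemma dilate_tilde3 (n : nat) :
  dilate (tilde 3) n = 1 * dilate (sigma 3) n + -16 * dilate (dilate (sigma 3)) n.
Proof. by rewrite (eq_dilate _ _ tilde3E) dilate_lincomb. Qed.

Lemma dilate_hat1 (n : nat) :
  dilate (hat 1) n = 1 * dilate (sigma 1) n + -2 * dilate (dilate (sigma 1)) n.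
Proof. by rewrite (eq_dilate _ _ hat1E) dilate_lincomb. Qed.

(** The left side is tilde 1 cut down to even arguments, which is the first factor
    in the sums over tilde(2m). *)
Lemma even_tilde1 (n : nat) :
  dilate (fun m => tilde 1 m.*2) n
    = -1 * dilate (sigma 1) n + -2 * dilate (dilate (sigma 1)) n.
Proof. by rewrite (eq_dilate _ _ tilde_double) dilate_lincomb. Qed.

Lemma conv_oddpart_sub (f g : nat -> rat) (n : nat) :
  conv (oddpart f) g n = conv f g n - conv (dilate (fun m => f m.*2)) g n.
Proof.
by rewrite /conv -sumrB; apply: eq_bigr => m _; rewrite oddpartE mulrBl.
Qed.

(** * The two ranges of summation *)

(** The condition 2 m < n may be dropped, since the truncated n - 2 m is 0 beyond it
    and g vanishes there. *)
Lemma sum_even_range (n : nat) (A f g : nat -> rat) :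
  f 0%N = 0 -> g 0%N = 0 ->
  (forall m, (0 < m)%N -> (m.*2 < n)%N -> A m = f m * g (n - m.*2)%N) ->
  \sum_(1 <= m < n.+1 | m%:R < n%:R / 2 :> rat) A m = conv (dilate f) g n.
Proof.
move=> f0 g0 AE; rewrite conv_dilate // -(big_mkord xpredT (fun m => f m * g (n - m.*2)%N)).
rewrite [RHS]big_ltn // f0 mul0r add0r big_mkcond /=.
apply: eq_big_nat => m /andP[m0 _].
rewrite ltr_pdivlMr // -natrM ltr_nat muln2; case: ltnP => mn; first exact: AE.
by have -> : (n - m.*2 = 0)%N; [lia | rewrite g0 mulr0].
Qed.

(** The indices 2 m - 1 with m >= 1 are the odd numbers 2 m + 1 with m >= 0; the
    condition 2 m - 1 < n is again enforced by the vanishing of g at 0. *)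
Lemma sum_odd_range (n : nat) (A f g : nat -> rat) :
  g 0%N = 0 ->
  (forall m, (m.*2.+1 < n)%N -> A m.+1 = f m.*2.+1 * g (n - m.*2.+1)%N) ->
  \sum_(1 <= m < n.+1 | m%:R < (n%:R + 1) / 2 :> rat) A m = conv (oddpart f) g n.
Proof.
move=> g0 AE; rewrite conv_oddpart //.
rewrite big_ord_recr /= (_ : (n - _ = 0)%N); last by lia.
rewrite g0 mulr0 addr0 big_add1 /= big_mkord big_mkcond /=.
apply: eq_bigr => m _.
rewrite ltr_pdivlMr // natr1 -natrM ltr_nat muln2 doubleS ltnS.
case: ltnP => mn; first exact: AE.
by have -> : (n - m.*2.+1 = 0)%N; [lia | rewrite g0 mulr0].
Qed.

Theorem theorem4p7 (n : nat) (hn : (0 < n)%N) :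
  8 * (\sum_(1 <= m < n.+1 | m%:R < n%:R / 2 :> rat)
           tsigma 1 (2 * m%:R) * tsigma 1 (n%:R - 2 * m%:R))
    = - tsigma 3 n%:R - tsigma 3 (n%:R / 2) + 4 * n%:R * tsigma 1 n%:R
      - 4 * tsigma 1 (n%:R / 2) - (2 * n%:R + 1) * hsigma 1 n%:R
      + (2 * n%:R + 7) * hsigma 1 (n%:R / 2)
  /\
  8 * (\sum_(1 <= m < n.+1 | m%:R < n%:R / 2 :> rat)
           tsigma 1 (2 * m%:R) * tsigma 1 (n%:R / 2 - m%:R))
    = - (2 * tsigma 3 (n%:R / 2)) + n%:R / 2 * tsigma 1 n%:R
      + (3 * n%:R - 3) * tsigma 1 (n%:R / 2) - n%:R / 2 * hsigma 1 n%:R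
      - (n%:R - 3) * hsigma 1 (n%:R / 2)
  /\
  8 * (\sum_(1 <= m < n.+1 | m%:R < (n%:R + 1) / 2 :> rat)
           tsigma 1 (2 * m%:R - 1) * tsigma 1 (n%:R - (2 * m%:R - 1)))
    = - tsigma 3 n%:R + tsigma 3 (n%:R / 2) + (2 * n%:R - 1) * hsigma 1 n%:R
      - (2 * n%:R - 1) * hsigma 1 (n%:R / 2)
  /\
  8 * (\sum_(1 <= m < n.+1 | m%:R < (n%:R + 1) / 2 :> rat)
           tsigma 1 (2 * m%:R - 1) * tsigma 1 ((n%:R + 1) / 2 - m%:R))
    = (n%:R - 1) * hsigma 1 n%:R - (n%:R - 1) * hsigma 1 (n%:R / 2)
  /\
  8 * (\sum_(1 <= m < n.+1 | m%:R < n%:R / 2 :> rat)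
           hsigma 1 (2 * m%:R) * tsigma 1 (n%:R - 2 * m%:R))
    = 1 / 3 * tsigma 3 n%:R - tsigma 3 (n%:R / 2) - 1 / 3 * tsigma 1 n%:R
      + (2 * n%:R - 1) * hsigma 1 (n%:R / 2)
  /\
  8 * (\sum_(1 <= m < n.+1 | m%:R < n%:R / 2 :> rat)
           hsigma 1 (2 * m%:R) * tsigma 1 (n%:R / 2 - m%:R))
    = - (2 / 3 * tsigma 3 (n%:R / 2)) - 1 / 3 * tsigma 1 (n%:R / 2)
      + (n%:R - 1) * hsigma 1 (n%:R / 2).
Proof.
have s0 : sigma 1 0 = 0 := sigma0 1.
have t0 := tilde0; have h0 := hat0.
rewrite !(tsigma_half _ _ hn) !(hsigma_half _ _ hn).
rewrite !(tsigma_natr _ _ hn) !(hsigma_natr _ _ hn).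
rewrite tilde3E dilate_tilde3 dilate_tilde1 dilate_hat1 hat1E tilde1E.
split; [|split; [|split; [|split; [|split]]]].
- rewrite (sum_even_range n _ (fun m => tilde 1 m.*2) (tilde 1)) //; last first.
    move=> m m0 mn; rewrite -natrM -natrB; last by lia.
    by rewrite !tsigma_natr ?mul2n //; lia.
  by rewrite (eq_conv _ _ _ _ _ even_tilde1 tilde1E) conv_bilinear !convolutionE; field.
- rewrite (sum_even_range n _ (fun m => tilde 1 m.*2) (dilate (tilde 1))) //; last first.
    move=> m m0 mn; rewrite -natrM tsigma_natr ?mul2n; last by lia.
    rewrite -tsigma_half ?subn_gt0 // natrB 1?ltnW // -mul2n natrM.
    by congr (_ * tsigma _ _); field.
  by rewrite (eq_conv _ _ _ _ _ even_tilde1 dilate_tilde1) conv_bilinear !convolutionE; field.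
- rewrite (sum_odd_range n _ (tilde 1) (tilde 1)) //; last first.
    move=> m mn; have -> : 2 * m.+1%:R - 1 = m.*2.+1%:R :> rat.
      by rewrite -natr1 -[m.*2.+1%:R]natr1 -mul2n natrM; ring.
    by rewrite -natrB 1?ltnW // !tsigma_natr // subn_gt0.
  rewrite conv_oddpart_sub (eq_conv _ _ _ _ _ tilde1E tilde1E).
  by rewrite (eq_conv _ _ _ _ _ even_tilde1 tilde1E) !conv_bilinear !convolutionE; field.
- rewrite (sum_odd_range n _ (tilde 1) (dilate (tilde 1))) //; last first.
    move=> m mn; have E : 2 * m.+1%:R - 1 = m.*2.+1%:R :> rat.
      by rewrite -natr1 -[m.*2.+1%:R]natr1 -mul2n natrM; ring.
    rewrite E tsigma_natr // -tsigma_half ?subn_gt0 // natrB 1?ltnW // -E.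
    by congr (_ * tsigma _ _); field.
  rewrite conv_oddpart_sub (eq_conv _ _ _ _ _ tilde1E dilate_tilde1).
  by rewrite (eq_conv _ _ _ _ _ even_tilde1 dilate_tilde1) !conv_bilinear !convolutionE;
    field.
- rewrite (sum_even_range n _ (hat 1) (tilde 1)) //; last first.
    move=> m m0 mn; rewrite -natrM -natrB; last by lia.
    rewrite hsigma_natr ?tsigma_natr ?mul2n ?hat_double //; lia.
  by rewrite (eq_conv _ _ _ _ _ dilate_hat1 tilde1E) conv_bilinear !convolutionE; field.
rewrite (sum_even_range n _ (hat 1) (dilate (tilde 1))) //; last first.
  move=> m m0 mn; rewrite -natrM hsigma_natr ?mul2n ?hat_double; last by lia.
  rewrite -tsigma_half ?subn_gt0 // natrB 1?ltnW // -mul2n natrM.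
  by congr (_ * tsigma _ _); field.
by rewrite (eq_conv _ _ _ _ _ dilate_hat1 dilate_tilde1) conv_bilinear !convolutionE; field.
Qed.
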